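(* Let $G$ be a connected graph of order $n\ge3$ with $m$ edges and Zagreb index $Zg(G)$, and let $\alpha\in[0,1]$ satisfy $\alpha\le1-\frac{n}{2m}$. Then \[E^{A_\alpha}(G)\le\alpha^2Zg(G)+(1-\alpha)^2\|A(G)\|_F^2-\frac{2\alpha m}{n^2}(2\alpha nm+2\alpha m+n)+\ln\left(\frac{\theta}{\Gamma}\right)+\frac{4\alpha m}{n}\sqrt{\frac{Zg(G)}{n}}-\sqrt{\frac{Zg(G)}{n}}\left(\sqrt{\frac{Zg(G)}{n}}-1\right),\] where $\Gamma=\left|\det\left(A_\alpha(G)-\frac{2\alpha m}{n}I_n\right)\right|$ and $\theta=\sqrt{\frac{Zg(G)}{n}}-\frac{2\alpha m}{n}$. Equality holds if and only if $G\cong K_n$ and $\alpha=0$, or $G$ is a $k$-regular graph with exactly three distinct $\alpha$-adjacency eigenvalues, given by $k$, $\alpha k+1$ and $\alpha k-1$.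
   Context: $G$ is a simple connected graph with vertex degrees $d_1,\dots,d_n$; $A(G)$ its adjacency matrix, $D(G)$ its diagonal degree matrix, $A_\alpha(G)=\alpha D(G)+(1-\alpha)A(G)$ with eigenvalues ($\alpha$-adjacency eigenvalues) $\rho_1\ge\dots\ge\rho_n$, and $E^{A_\alpha}(G)=\sum_{i=1}^n\left|\rho_i-\frac{2\alpha m}{n}\right|$. $Zg(G)=\sum_i d_i^2$; $\|A(G)\|_F^2$ is the squared Frobenius norm of $A(G)$ (equal to $2m$); $I_n$ is the identity matrix; $\ln$ is the natural logarithm; $K_n$ is the complete graph. *)

(* Defs.v *)
From HB Require Import structures.
From mathcomp Require Import all_boot all_order all_algebra.
From mathcomp Require Import polyrcf.
From mathcomp Require Import reals ereal exp.

Set Implicit Arguments.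
Unset Strict Implicit.
Unset Printing Implicit Defensive.

Import Order.TTheory GRing.Theory Num.Theory.
Local Open Scope ring_scope.

Record sgraph (n : nat) := SGraph {
  adj :> rel 'I_n;
  adj_sym : symmetric adj;
  adj_irr : irreflexive adj }.

Lemma complete_sym n : symmetric (fun i j : 'I_n => i != j).
Proof. by move=> i j; rewrite eq_sym. Qed.

Lemma complete_irr n : irreflexive (fun i j : 'I_n => i != j).
Proof. by move=> i; rewrite eqxx. Qed.

Definition complete_graph (n : nat) : sgraph n :=
  SGraph (@complete_sym n) (@complete_irr n).

Definition graph_iso (n n' : nat) (G : sgraph n) (H : sgraph n') : Prop :=
  exists f : 'I_n -> 'I_n', bijective f /\ forall i j, G i j = H (f i) (f j).

Definition graph_connected (n : nat) (G : sgraph n) : Prop :=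
  forall i j, connect (adj G) i j.

Definition degree (n : nat) (G : sgraph n) (i : 'I_n) : nat :=
  #|[set j | G i j]|.

Definition regular (n : nat) (G : sgraph n) (k : nat) : Prop :=
  forall i, degree G i = k.

(* An edge {i, j} is counted once, as the pair (i, j) with i < j. *)
Definition num_edges (n : nat) (G : sgraph n) : nat :=
  #|[set p : 'I_n * 'I_n | (p.1 < p.2)%N && G p.1 p.2]|.

Definition zagreb (n : nat) (G : sgraph n) : nat :=
  (\sum_(i < n) degree G i ^ 2)%N.

Definition frobenius_norm (R : rcfType) (m n : nat) (M : 'M[R]_(m, n)) : R :=
  Num.sqrt (\sum_(i < m) \sum_(j < n) `|M i j| ^+ 2).

(* The real roots of the characteristic polynomial, each repeated according to
   its multiplicity, in nonincreasing order. For a symmetric M of size n these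
   are all its eigenvalues, so the list has length n. *)
Definition spectrum (R : rcfType) (n : nat) (M : 'M[R]_n) : seq R :=
  let p := char_poly M in
  sort (fun x y => y <= x) (flatten [seq nseq (mup x p) x | x <- rootsR p]).

Definition adjmx (R : rcfType) (n : nat) (G : sgraph n) : 'M[R]_n :=
  \matrix_(i, j) (G i j)%:R.

Definition degmx (R : rcfType) (n : nat) (G : sgraph n) : 'M[R]_n :=
  diag_mx (\row_i (degree G i)%:R).

Definition alpha_mx (R : rcfType) (n : nat) (G : sgraph n) (alpha : R) :
    'M[R]_n :=
  alpha *: degmx R G + (1 - alpha) *: adjmx R G.

Definition alpha_energy (R : rcfType) (n : nat) (G : sgraph n) (alpha : R) : R :=
  \sum_(rho <- spectrum (alpha_mx G alpha))
     `|rho - 2 * alpha * (num_edges G)%:R / n%:R|.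

(* Main.v *)
(* Write [t = 2 alpha m / n] and [s_i = rho_i - t]. The function
   [g x = x^2 - x - ln x] is nonnegative for [x > 0], vanishes only at [1] and
   increases on [1, +oo). Summing [|s_i| <= s_i^2 - ln |s_i|] over [i >= 2]
   gives [E <= sum s_i^2 - ln Gamma - g s_1], and [g theta <= g s_1] since
   [1 <= theta <= s_1]: the hypothesis on [alpha] gives [1 <= theta], and
   [n rho_1^2 >= |A 1|^2 = Zg] gives [theta <= s_1], because Perron's argument
   shows that [rho_1] is the spectral radius.
   Equality means [s_1 = theta] and [|s_i| = 1] for the other [i]. If
   [theta = 1] then [G] is 1-regular, which is impossible for [n >= 3];
   otherwise [rho_1] strictly dominates the other eigenvalues, so the all-ones vector is an
   eigenvector and [G] is [k]-regular. As [sum s_i = 0], the value [-1] occurs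
   among the [s_i], and if [+1] does not then [theta = n - 1], which forces
   [G = K_n] and [alpha = 0]. Conversely, [k] is a simple eigenvalue of a
   connected [k]-regular graph. *)
Require Import Defs.
From HB Require Import structures.
From mathcomp Require Import all_boot all_order all_algebra.
From mathcomp Require Import complex polyrcf.
From mathcomp Require Import reals ereal exp.
From mathcomp Require Import ring lra.

Set Implicit Arguments.
Unset Strict Implicit.
Unset Printing Implicit Defensive.

Import Order.TTheory GRing.Theory Num.Theory.
Local Open Scope ring_scope.

(** * Spectra and unitary diagonalization of real symmetric matrices *)

(** The multiplicity of a root of a split polynomial is its count in [s], and concatenating these
    blocks over [undup s] restores [s] up to order. *)
Lemma spectrum_prod_XsubC (R : rcfType) n (A : 'M[R]_n) (s : seq R) :
  char_poly A = \prod_(x <- s) ('X - x%:P) -> perm_eq (spectrum A) s.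
Proof.
move=> defA; rewrite /spectrum perm_sort defA.
set p := \prod_(_ <- _) _.
have p0 : p != 0 by apply/monic_neq0/monic_prod_XsubC.
have roots_s : perm_eq (rootsR p) (undup s).
  apply: uniq_perm; rewrite ?undup_uniq //.
    by apply: (sorted_uniq lt_trans ltxx); apply: sorted_roots.
  by move=> x; rewrite mem_undup -(roots_on_rootsR p0) in_itv /=
    root_prod_XsubC.
apply: perm_trans (perm_count_undup s).
rewrite (eq_map (g := fun x => nseq (count_mem x s) x)); last first.
  by move=> x /=; rewrite mu_prod_XsubC.
by apply/perm_flatten/perm_map.
Qed.

Local Notation toC := (map_mx (real_complex _)).

(* [P] is the unitary matrix whose rows are eigenvectors of [A]. *)
Definition diagonalizes (R : rcfType) n (A : 'M[R]_n) (d : 'rV[R]_n)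
    (P : 'M[R[i]]_n) : Prop :=
  P *m map_mx Num.conj P^T = 1%:M /\
  toC A = map_mx Num.conj P^T *m diag_mx (toC d) *m P.

(** The complexification of [A] is Hermitian, so the spectral theorem for normal matrices applies,
    and the eigenvalues, being real, descend to [R]. *)
Lemma symmetric_diagonalizes (R : rcfType) n (A : 'M[R]_n) :
  A^T = A -> exists d P, diagonalizes A d P.
Proof.
move=> symA; have hermA : toC A \is hermsymmx.
  apply: realsym_hermsym.
    by apply/is_hermitianmxP; rewrite expr0 scale1r map_mx_id // map_trmx symA.
  by apply/mxOverP=> i j; rewrite mxE complex_real.
have /orthomx_spectralP := hermitian_normalmx hermA.
have /unitarymxP PPt := spectral_unitarymx (toC A).
rewrite invmx_unitary ?spectral_unitarymx // => defA.
exists (map_mx (@complex.Re R) (spectral_diag (toC A))), (spectralmx (toC A)).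
split=> //; rewrite [LHS]defA; congr (_ *m diag_mx _ *m _).
apply/rowP=> j; rewrite !mxE RRe_real //.
by have /mxOverP := hermitian_spectral_diag_real hermA; apply.
Qed.

Section Diagonalized.
Variables (R : rcfType) (n : nat).
Implicit Types (A B : 'M[R]_n) (d e : 'rV[R]_n) (P : 'M[R[i]]_n).

Lemma diagonalizes_mul A B d e P :
  diagonalizes A d P -> diagonalizes B e P ->
  diagonalizes (A *m B) (\row_i (d 0 i * e 0 i)) P.
Proof.
move=> [PPt defA] [_ defB]; split=> //.
rewrite map_mxM defA defB !mulmxA -[_ *m P *m _]mulmxA PPt mulmx1.
rewrite -[X in X *m P]mulmxA mulmx_diag; congr (_ *m diag_mx _ *m _).
by apply/rowP=> i; rewrite !mxE rmorphM.
Qed.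

Lemma diagonalizes_sub_scalar A d P (t : R) :
  diagonalizes A d P -> diagonalizes (A - t%:M) (\row_i (d 0 i - t)) P.
Proof.
move=> [PPt defA]; split=> //.
have -> : toC (\row_i (d 0 i - t)) = toC d - const_mx t%:C%C.
  by apply/rowP=> i; rewrite !mxE rmorphB.
rewrite map_mxB map_scalar_mx defA linearB /= diag_const_mx mulmxBr mulmxBl.
by rewrite mul_mx_scalar -scalemxAl (mulmx1C PPt) scalemx1.
Qed.

Lemma diagonalizes_char_poly A d P :
  diagonalizes A d P -> char_poly A = \prod_i ('X - (d 0 i)%:P).
Proof.
move=> [PPt defA]; apply: (@map_poly_inj _ _ (real_complex R)).
rewrite map_char_poly defA rmorph_prod /=.
set Pt := map_mx _ P^T in PPt *; set D := diag_mx _.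
have PtP : map_mx polyC Pt *m map_mx polyC P = 1%:M.
  by rewrite -map_mxM /= (mulmx1C PPt) map_mx1.
have -> : char_poly (Pt *m D *m P) = char_poly D.
  rewrite /char_poly /char_poly_mx !map_mxM /=.
  rewrite -[X in _ = \det X]mul1mx.
  (* Scalar matrices commute with [Pt], and [Pt P = 1], so ['X%:M] is conjugated to itself. *)
  have -> : 'X%:M - map_mx polyC Pt *m map_mx polyC D *m map_mx polyC P
    = map_mx polyC Pt *m ('X%:M - map_mx polyC D) *m map_mx polyC P.
    by rewrite mulmxBr mulmxBl mul_mx_scalar -scalemxAl PtP scalemx1.
  by rewrite !det_mulmx mulrAC -!det_mulmx PtP.
rewrite char_poly_trig ?diag_mx_is_trig //.
by apply: eq_bigr => i _; rewrite !mxE eqxx mulr1n rmorphB /= map_polyX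
  map_polyC.
Qed.

Lemma diagonalizes_trace A d P :
  diagonalizes A d P -> \tr A = \sum_i d 0 i.
Proof.
move=> [PPt defA]; apply: (@complexI R).
rewrite -(trace_map_mx (real_complex R)) defA mxtrace_mulC mulmxA PPt mul1mx.
by rewrite mxtrace_diag rmorph_sum; apply: eq_bigr => i _; rewrite mxE.
Qed.

Lemma diagonalizes_det A d P :
  diagonalizes A d P -> \det A = \prod_i d 0 i.
Proof.
move=> [PPt defA]; apply: (@complexI R).
rewrite -(det_map_mx (real_complex R)) defA !det_mulmx mulrAC -det_mulmx.
rewrite (mulmx1C PPt) det1 mul1r det_diag rmorph_prod.
by apply: eq_bigr => i _; rewrite mxE.
Qed.

Lemma diagonalizes_eigenvalue A d P (x : R) :
  diagonalizes A d P -> eigenvalue A x = (x \in codom (d 0)).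
Proof.
move=> /diagonalizes_char_poly defA; rewrite eigenvalue_root_char defA.
rewrite -big_enum -(big_map (d 0) predT (fun x => 'X - x%:P)).
by rewrite root_prod_XsubC.
Qed.

Lemma perm_spectrum A d P :
  diagonalizes A d P -> perm_eq (spectrum A) (codom (d 0)).
Proof.
move=> /diagonalizes_char_poly defA; apply: spectrum_prod_XsubC.
by rewrite defA /codom /image_mem big_map big_enum.
Qed.

(* [w i] is the squared modulus of the [i]-th coordinate of [u] in the
   eigenbasis; it depends on [P] and [u] only. *)
Lemma diagonalizes_form P (u : 'rV[R]_n) :
  exists2 w : 'I_n -> R, forall i, 0 <= w i &
    forall A d, diagonalizes A d P -> (u *m A *m u^T) 0 0 = \sum_i d 0 i * w i.
Proof.
pose y := toC u *m map_mx Num.conj P^T.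
exists (fun i => complex.Re (y 0 i) ^+ 2 + complex.Im (y 0 i) ^+ 2).
  by move=> i; rewrite addr_ge0 ?sqr_ge0.
move=> A d [PPt defA]; apply: (@complexI R).
have -> : ((u *m A *m u^T) 0 0)%:C%C = (toC (u *m A *m u^T)) 0 0.
  by rewrite [RHS]mxE.
rewrite !map_mxM defA !mulmxA -/y -mulmxA.
have -> : P *m toC u^T = map_mx Num.conj y^T.
  rewrite /y trmx_mul map_mxM map_trmx trmxK -map_mx_comp.
  rewrite (map_mx_id (@conjCK _)). congr (_ *m _).
  by apply/colP=> i; rewrite !mxE; exact/esym/conjc_real.
rewrite mxE rmorph_sum; apply: eq_bigr => i _.
rewrite mul_mx_diag !mxE rmorphM /= add_Re2_Im2 normCK -mulrA.
exact: mulrCA.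
Qed.

(* Two rows of [P] with the same eigenvalue would both be constant, hence
   proportional, while they are orthogonal. *)
Lemma diagonalizes_simple A d P (x : R) (i j : 'I_n) :
    diagonalizes A d P ->
    (forall u : 'rV[R]_n, u *m A = x *: u -> exists c, u = const_mx c) ->
  d 0 i = x -> d 0 j = x -> i = j.
Proof.
move=> [PPt defA] eigen_const di dj.
have PA : P *m toC A = diag_mx (toC d) *m P by rewrite defA !mulmxA PPt mul1mx.
have row_const l : d 0 l = x -> exists c : R[i], row l P = const_mx c.
  move=> dl; have rowA : row l P *m toC A = x%:C%C *: row l P.
    rewrite -row_mul PA; apply/rowP=> k.
    by rewrite mul_diag_mx !mxE dl.
  have entry k : \sum_h P l h * (A h k)%:C%C = x%:C%C * P l k.
    move/rowP/(_ k): rowA; rewrite !mxE => <-.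
    by apply: eq_bigr => h _; rewrite !mxE.
  (* [eigen_const] concerns real rows; as [A] and [x] are real, the real and imaginary parts are
     eigenvectors separately. *)
  have [|a /rowP re_const] := eigen_const (\row_k complex.Re (P l k)).
    apply/rowP=> k; rewrite !mxE; have /(congr1 (@complex.Re R)) := entry k.
    rewrite raddf_sum /=; case: (P l k) => p q /=; rewrite mul0r subr0 => <-.
    by apply: eq_bigr => h _; rewrite !mxE; case: (P l h) => r s /=;
      rewrite mulr0 subr0.
  have [|b /rowP im_const] := eigen_const (\row_k complex.Im (P l k)).
    apply/rowP=> k; rewrite !mxE; have /(congr1 (@complex.Im R)) := entry k.
    rewrite raddf_sum /=; case: (P l k) => p q /=; rewrite mul0r addr0 => <-.
    by apply: eq_bigr => h _; rewrite !mxE; case: (P l h) => r s /=;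
      rewrite mulr0 add0r.
  exists (Complex a b); apply/rowP=> k; rewrite !mxE.
  by move: (re_const k) (im_const k); rewrite !mxE => <- <-; case: (P l k).
have [[a Pi] [b Pj]] := (row_const i di, row_const j dj).
apply/eqP; apply: contraT => i'j.
(* A row of [P] has norm 1, that is [n c c^* = 1], so neither factor vanishes. *)
have norm l c : row l P = const_mx c -> (c != 0) && (n%:R != 0 :> R[i]).
  move=> /rowP Pl; have /matrixP/(_ l l) := PPt; rewrite !mxE eqxx.
  rewrite (eq_bigr (fun _ => c * c^*)) => [|k _].
    rewrite sumr_const card_ord -[X in X = _]mulr_natr -negb_or;
      apply: contra_eqN.
    by case/orP=> /eqP->; rewrite ?(mul0r, mulr0) eq_sym oner_neq0.
  by rewrite !mxE; move: (Pl k); rewrite !mxE => ->.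
have /matrixP/(_ i j) := PPt; rewrite !mxE (negPf i'j).
rewrite (eq_bigr (fun _ => a * b^*)) => [|k _]; last first.
  by rewrite !mxE; move/rowP/(_ k): Pi; move/rowP/(_ k): Pj;
    rewrite !mxE => -> ->.
have [/andP[a0 n0] /andP[b0 _]] := (norm _ _ Pi, norm _ _ Pj).
move/eqP; rewrite sumr_const card_ord -[X in X == _]mulr_natr mulf_eq0
  (negPf n0) orbF.
by rewrite mulf_eq0 (negPf a0) fmorph_eq0 (negPf b0).
Qed.

End Diagonalized.

(** * Quadratic forms and Perron's argument *)

Lemma dotmx_self (R : comNzRingType) n (u : 'rV[R]_n) :
  (u *m u^T) 0 0 = \sum_i u 0 i ^+ 2.
Proof. by rewrite mxE; apply: eq_bigr => i _; rewrite mxE expr2. Qed.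

Lemma form_mxE (R : comNzRingType) n (A : 'M[R]_n) (u : 'rV[R]_n) :
  (u *m A *m u^T) 0 0 = \sum_i \sum_j u 0 i * A i j * u 0 j.
Proof.
rewrite mxE exchange_big /=; apply: eq_bigr => j _.
by rewrite !mxE mulr_suml; apply: eq_bigr => i _.
Qed.

Lemma form_sub_scalar (R : comNzRingType) n (A : 'M[R]_n) (u : 'rV[R]_n) t :
  (u *m (A - t%:M) *m u^T) 0 0 = (u *m A *m u^T) 0 0 - t * \sum_i u 0 i ^+ 2.
Proof.
rewrite mulmxBr mulmxBl mul_mx_scalar -scalemxAl -dotmx_self.
by rewrite [LHS]mxE [X in _ + X]mxE [X in _ - X]mxE.
Qed.

Section Spectral.
Variables (R : rcfType) (n : nat).
Variables (A : 'M[R]_n) (d : 'rV[R]_n) (P : 'M[R[i]]_n) (r : R).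
Hypotheses (diagA : diagonalizes A d P) (d_le : forall i, d 0 i <= r).

(** The eigenvalues [d i - r] of [A - r] are nonpositive and the weights [w i] nonnegative. *)
Lemma form_le (u : 'rV[R]_n) :
  (u *m A *m u^T) 0 0 <= r * \sum_i u 0 i ^+ 2.
Proof.
rewrite -subr_le0 -form_sub_scalar.
have [w w_ge0 /(_ _ _ (diagonalizes_sub_scalar r diagA)) ->] :=
  diagonalizes_form P u.
by apply: sumr_le0 => i _; rewrite mxE mulr_le0_ge0 ?subr_le0.
Qed.

(** Replacing an eigenvector by its entrywise absolute values keeps its norm and, as [A] is
    nonnegative, can only enlarge the absolute value of the form. *)
Lemma perron_bound : (forall i j, 0 <= A i j) -> forall i, `|d 0 i| <= r.
Proof.
move=> A_ge0 i.
have : eigenvalue A (d 0 i) by rewrite (diagonalizes_eigenvalue _ diagA)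
  codom_f.
case/eigenvalueP=> v vA v0.
have v_gt0 : 0 < \sum_j v 0 j ^+ 2.
  rewrite lt0r sumr_ge0 ?andbT => [|j _]; last exact: sqr_ge0.
  apply: contra v0; rewrite psumr_eq0 => [/allP all0|j _]; last exact: sqr_ge0.
  apply/eqP/rowP=> j; have := all0 j (mem_index_enum j).
  by rewrite /= sqrf_eq0 mxE => /eqP.
rewrite -(ler_pM2r v_gt0); pose y : 'rV[R]_n := \row_j `|v 0 j|.
have yy : \sum_j v 0 j ^+ 2 = \sum_j y 0 j ^+ 2.
  by apply: eq_bigr => j _; rewrite mxE real_normK ?num_real.
apply: (@le_trans _ _ ((y *m A *m y^T) 0 0)); last by rewrite yy form_le.
have <- : `|(v *m A *m v^T) 0 0| = `|d 0 i| * \sum_j v 0 j ^+ 2.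
  by rewrite vA -scalemxAl mxE dotmx_self normrM [X in _ * X]ger0_norm ?ltW.
rewrite !form_mxE; apply: le_trans (ler_norm_sum _ _ _) _.
apply: ler_sum => j _; apply: le_trans (ler_norm_sum _ _ _) _.
by apply: ler_sum => k _; rewrite !normrM !mxE (ger0_norm (A_ge0 j k)).
Qed.

Lemma form_sqr_le (u : 'rV[R]_n) : (forall i, `|d 0 i| <= r) ->
  (u *m (A *m A) *m u^T) 0 0 <= r ^+ 2 * \sum_i u 0 i ^+ 2.
Proof.
move=> abs_le; rewrite -subr_le0 -form_sub_scalar.
have [w w_ge0] := diagonalizes_form P u.
move=> /(_ _ _ (diagonalizes_sub_scalar (r ^+ 2)
  (diagonalizes_mul diagA diagA))).
move=> ->; apply: sumr_le0 => i _; rewrite !mxE mulr_le0_ge0 // subr_le0 -expr2.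
have := abs_le i; rewrite -[d 0 i ^+ 2]real_normK ?num_real // => le_r.
by rewrite lerXn2r ?nnegrE // (le_trans _ le_r).
Qed.

(** Equality makes every term [(d i ^ 2 - r ^ 2) w i] vanish, so [w i = 0] unless [d i = r]. Hence
    [|u (A - r)|^2], the sum of [(d i - r)^2 w i], is zero. *)
Lemma form_sqr_eq (u : 'rV[R]_n) : A^T = A ->
    (forall i, d 0 i = r \/ `|d 0 i| < r) ->
    (u *m (A *m A) *m u^T) 0 0 = r ^+ 2 * \sum_i u 0 i ^+ 2 ->
  u *m A = r *: u.
Proof.
move=> symA dr /eqP; rewrite -subr_eq0 -form_sub_scalar.
have [w w_ge0 form_u] := diagonalizes_form P u.
have diagAr := diagonalizes_sub_scalar r diagA.
rewrite (form_u _ _ (diagonalizes_sub_scalar (r ^+ 2)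
  (diagonalizes_mul diagA diagA))).
have lt_r i : `|d 0 i| < r -> d 0 i * d 0 i - r ^+ 2 < 0.
  move=> dlt; rewrite subr_lt0 -expr2 -[d 0 i ^+ 2]real_normK ?num_real //.
  by rewrite ltrXn2r // nnegrE // (le_trans _ (ltW dlt)).
rewrite -oppr_eq0 -sumrN psumr_eq0 => [/allP w0|i _]; last first.
  rewrite !mxE oppr_ge0 mulr_le0_ge0 //; have [->|/lt_r/ltW//] := dr i.
  by rewrite expr2 subrr.
have : (u *m ((A - r%:M) *m (A - r%:M)) *m u^T) 0 0 = 0.
  rewrite (form_u _ _ (diagonalizes_mul diagAr diagAr)) big1 // => i _.
  rewrite !mxE; have [->|/lt_r lt0] := dr i; first by rewrite subrr !mul0r.
  have := w0 i (mem_index_enum i).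
  by rewrite /= !mxE oppr_eq0 mulf_eq0 lt_eqF //= => /eqP->; rewrite mulr0.
have -> : u *m ((A - r%:M) *m (A - r%:M)) *m u^T
    = (u *m (A - r%:M)) *m (u *m (A - r%:M))^T.
  have -> : (u *m (A - r%:M))^T = (A - r%:M) *m u^T.
    by rewrite trmx_mul; congr (_ *m _); rewrite linearB /= tr_scalar_mx symA.
  by rewrite !mulmxA.
rewrite dotmx_self => /eqP.
rewrite psumr_eq0 => [/allP z0|i _]; last exact: sqr_ge0.
apply/eqP; rewrite -subr_eq0 -mul_mx_scalar -mulmxBr; apply/eqP/rowP=> i.
have := z0 i (mem_index_enum i).
by rewrite /= sqrf_eq0 [RHS]mxE => /eqP.
Qed.

End Spectral.

(** * The gap function [x^2 - x - ln x] *)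

Section Gap.
Variable R : realType.
Implicit Types x y : R.

(** As [ln x <= x - 1], the expression is at least [(x - 1)^2], which also settles when it
    vanishes. *)
Lemma sqr_sub_ln_ge0 x : 0 < x -> 0 <= x ^+ 2 - x - ln x.
Proof.
move=> x0; have := @le_ln1Dx R (x - 1); rewrite addrCA subrr addr0.
by move=> /(_ ltac:(lra)) lnx; nra.
Qed.

Lemma sqr_sub_ln_eq0 x : 0 < x -> x ^+ 2 - x - ln x = 0 -> x = 1.
Proof.
move=> x0 gap0; have := @le_ln1Dx R (x - 1); rewrite addrCA subrr addr0.
move=> /(_ ltac:(lra)) lnx; apply/eqP;
  rewrite -subr_eq0 -sqrf_eq0 eq_le sqr_ge0.
by rewrite andbT; nra.
Qed.

(** Here [ln y - ln x <= y / x - 1 <= y - x], so the difference is at least [(y - x)(x + y - 2)]. *)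
Lemma sqr_sub_ln_lt x y : 1 <= x -> x < y ->
  x ^+ 2 - x - ln x < y ^+ 2 - y - ln y.
Proof.
move=> x1 xy; have x0 : 0 < x by lra.
have y0 : 0 < y by lra.
have lnyx : ln y - ln x <= y - x.
  rewrite -ln_div ?posrE //; apply: (@le_trans _ _ (y / x - 1)).
    have := @le_ln1Dx R (y / x - 1); rewrite addrCA subrr addr0; apply.
    by rewrite ltrBrDr addNr divr_gt0.
  by rewrite -[X in y / x - X](divff (lt0r_neq0 x0)) -mulrBl ler_pdivrMr //;
    nra.
nra.
Qed.

Lemma ln_prod (I : finType) (F : I -> R) :
  (forall i, 0 < F i) -> ln (\prod_i F i) = \sum_i ln (F i).
Proof.
move=> F0; suff [] : 0 < \prod_i F i /\ ln (\prod_i F i)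
  = \sum_i ln (F i) by [].
apply: (big_rec2 (fun x y => 0 < x /\ ln x = y)) => [|i y x _ [x0 <-]].
  by rewrite ln1.
by rewrite mulr_gt0 ?lnM ?posrE.
Qed.

(* The difference of the two sides is the sum of [g |s i|] over [i != i0] plus
   [g (s i0) - g theta], where [g x = x^2 - x - ln x]. *)
Lemma sum_norm_le (I : finType) (s : I -> R) (i0 : I) (theta : R) :
    1 <= theta -> theta <= s i0 -> (forall i, s i != 0) ->
  let bound := \sum_i s i ^+ 2 + ln (theta / \prod_i `|s i|)
               - theta ^+ 2 + theta in
  \sum_i `|s i| <= bound /\
  (\sum_i `|s i| = bound <->
     s i0 = theta /\ forall i, i != i0 -> `|s i| = 1).
Proof.
move=> theta1 theta_le s0 bound; pose g (x : R) := x ^+ 2 - x - ln x.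
have s_gt0 i : 0 < `|s i| by rewrite normr_gt0.
have s_i0 : `|s i0| = s i0 by rewrite ger0_norm //
  (le_trans _ theta_le) ?(le_trans ler01).
have bound_gap : bound - \sum_i `|s i|
    = \sum_(i | i != i0) g `|s i| + (g (s i0) - g theta).
  rewrite /bound ln_div ?posrE ?prodr_gt0 ?(lt_le_trans ltr01) //.
  have : \sum_i g `|s i| = g (s i0) + \sum_(i | i != i0) g `|s i|.
    by rewrite (bigD1 i0) //= s_i0.
  rewrite ln_prod //; move: (\sum_(i | i != i0) _) => T; rewrite /g !sumrB.
  rewrite (eq_bigr (fun i => s i ^+ 2)) => [eq_T|i _]; first by lra.
  by rewrite real_normK ?num_real.
have g_ge0 : 0 <= \sum_(i | i != i0) g `|s i|.
  by apply: sumr_ge0 => i _; exact: sqr_sub_ln_ge0.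
have g_i0 : 0 <= g (s i0) - g theta.
  rewrite subr_ge0; have [->//|ne] := eqVneq theta (s i0).
  by apply/ltW/sqr_sub_ln_lt; rewrite // lt_neqAle ne.
split; first by rewrite -subr_ge0 bound_gap addr_ge0.
split=> [/esym/eqP|[si0 s1]]; last first.
  apply/esym/eqP; rewrite -subr_eq0 bound_gap si0 subrr addr0 big1 //
    => i /s1->.
  by rewrite /g ln1 expr1n !subrr.
rewrite -subr_eq0 bound_gap paddr_eq0 // => /andP[/eqP sum0 /eqP gi0]; split.
  apply/eqP; rewrite eq_sym; apply: contraT => ne.
  have := sqr_sub_ln_lt theta1 (_ : theta < s i0); rewrite lt_neqAle ne.
  by move=> /(_ theta_le); rewrite -subr_gt0 -/(g _) -/(g theta) gi0 ltxx.
move=> i i'i0; apply: sqr_sub_ln_eq0 => //.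
by apply: (psumr_eq0P _ sum0) => // j _; exact: sqr_sub_ln_ge0.
Qed.

End Gap.

(** * Degrees, edges and adjacency *)

Section Graph.
Variables (n : nat) (G : sgraph n).

Lemma degreeE i : degree G i = (\sum_j G i j)%N.
Proof.
rewrite /degree -sum1_card big_mkcond /=.
by apply: eq_bigr => j _; rewrite inE; case: (G i j).
Qed.

Lemma sum_degree : (\sum_i degree G i = 2 * num_edges G)%N.
Proof.
rewrite (eq_bigr _ (fun i _ => degreeE i)).
have -> : num_edges G = (\sum_(i < n) \sum_(j < n) ((i < j)%N && G i j))%N.
  rewrite pair_big /= /num_edges -sum1_card big_mkcond /=.
  by apply: eq_bigr => p _; rewrite inE; case: (_ && _).
(* Transposing one of the two copies makes it run over the pairs with [j < i]; the diagonal
   contributes nothing. *)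
rewrite mul2n -addnn [X in (_ + X)%N]exchange_big /= -big_split /=.
apply: eq_bigr => i _; rewrite -big_split /=; apply: eq_bigr => j _.
rewrite (adj_sym G j i); case: (ltngtP i j) => // ij; first by rewrite addn0.
by rewrite (val_inj ij) adj_irr.
Qed.

Lemma degree_le i : (degree G i <= n.-1)%N.
Proof.
have -> : n.-1 = #|[set~ i]| by rewrite cardsC1 card_ord.
by apply/subset_leq_card/subsetP => j; rewrite !inE; apply: contraTneq => ->;
  rewrite adj_irr.
Qed.

Lemma regular_complete : regular G n.-1 -> forall i j, G i j = (i != j).
Proof.
move=> reg i j; have /subset_cardP/(_ _)/(_ j) : #|[set j | G i j]| =
  #|[set~ i]|.
  by rewrite [LHS]reg cardsC1 card_ord.
rewrite !inE eq_sym; apply; apply/subsetP => k; rewrite !inE.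
by apply: contraTneq => ->; rewrite adj_irr.
Qed.

Lemma iso_complete_regular :
  graph_iso G (complete_graph n) -> regular G n.-1.
Proof.
case=> f [bij_f adj_f] i.
have -> : n.-1 = #|[set~ i]| by rewrite cardsC1 card_ord.
apply: eq_card => j; rewrite !inE adj_f /= (inj_eq (bij_inj bij_f)).
by rewrite eq_sym.
Qed.

Lemma regular_sum_degree k : regular G k -> (2 * num_edges G = n * k)%N.
Proof.
move=> reg; rewrite -sum_degree (eq_bigr (fun=> k)) => [|i _]; last exact: reg.
by rewrite sum_nat_const card_ord.
Qed.

(** A vertex and its only neighbour form a set closed under adjacency, hence the whole graph. *)
Lemma connected_1regular : graph_connected G -> regular G 1 -> (n <= 2)%N.
Proof.
case: n G => // n' H conn reg; have /eqP/cards1P[j Nj] := reg ord0.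
have adj_j i : H ord0 i = (i == j) by move/setP/(_ i): Nj; rewrite !inE.
have {}adj_j' i : H j i = (i == ord0).
  have /eqP/cards1P[l Nl] := reg j.
  have adj_l h : H j h = (h == l) by move/setP/(_ h): Nl; rewrite !inE.
  have : H j ord0 by rewrite adj_sym adj_j.
  by rewrite adj_l => /eqP->; rewrite adj_l.
have clos : fingraph.closed (adj H) (mem [set ord0; j]).
  apply: intro_closed => [|x y xy]; first exact/sym_connect_sym/adj_sym.
  rewrite !inE => /orP[]/eqP ex; move: xy; rewrite ex.
    by rewrite adj_j => ->; rewrite orbT.
  by rewrite adj_j' => ->.
rewrite -(card_ord n'.+1); apply: leq_trans (_ : #|[set ord0; j]| <= 2)%N.
  apply/subset_leq_card/subsetP => i _.
  by rewrite -(closed_connect clos (conn ord0 i)) !inE eqxx.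
by rewrite cards2; case: (_ != _).
Qed.

Variable R : rcfType.

Lemma row_sum_adj i : \sum_j (G i j)%:R = (degree G i)%:R :> R.
Proof. by rewrite degreeE natr_sum. Qed.

Lemma sum_degreeR : \sum_i (degree G i)%:R = 2 * (num_edges G)%:R :> R.
Proof. by rewrite -natr_sum sum_degree natrM. Qed.

Lemma zagrebR : \sum_i (degree G i)%:R ^+ 2 = (zagreb G)%:R :> R.
Proof. by rewrite natr_sum; apply: eq_bigr => i _; rewrite natrX. Qed.

Lemma frobenius_adj : frobenius_norm (adjmx R G) ^+ 2 = 2 * (num_edges G)%:R.
Proof.
rewrite sqr_sqrtr => [|]; last first.
  by apply: sumr_ge0 => i _; apply: sumr_ge0 => j _; rewrite sqr_ge0.
rewrite -sum_degreeR; apply: eq_bigr => i _; rewrite -row_sum_adj.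
by apply: eq_bigr => j _; rewrite mxE; case: (G i j);
  rewrite ?normr1 ?normr0 ?expr1n ?expr0n.
Qed.

(* [k |x|^2 - x Adj x^T] is half the sum of [(x i - x j)^2] over the pairs of
   adjacent vertices. *)
Lemma connected_eigen_const k (u : 'rV[R]_n) :
    graph_connected G -> regular G k ->
  u *m adjmx R G = k%:R *: u -> forall i j, u 0 i = u 0 j.
Proof.
move=> conn reg /rowP ukA.
have adjE i : \sum_j (G i j)%:R * u 0 j = k%:R * u 0 i.
  have := ukA i; rewrite !mxE => <-.
  by apply: eq_bigr => j _; rewrite mxE adj_sym mulrC.
have : \sum_i \sum_j (G i j)%:R * (u 0 i - u 0 j) ^+ 2 = 0.
  have termE i j : (G i j)%:R * (u 0 i - u 0 j) ^+ 2
      = (G i j)%:R * u 0 i ^+ 2 + (G i j)%:R * u 0 j ^+ 2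
        - 2 * (u 0 i * ((G i j)%:R * u 0 j)) by ring.
  have rowE i : \sum_j (G i j)%:R * u 0 i ^+ 2 = k%:R * u 0 i ^+ 2.
    by rewrite -mulr_suml row_sum_adj reg.
  under eq_bigr => i _ do under eq_bigr => j _ do rewrite termE.
  under eq_bigr => i _ do rewrite big_split sumrN big_split /= rowE -mulr_sumr.
  under eq_bigr => i _ do rewrite -mulr_sumr adjE.
  rewrite sumrB big_split /= [X in _ + X - _]exchange_big /=.
  under [X in _ + X - _]eq_bigr => i _ do
    (under eq_bigr => j _ do rewrite adj_sym); rewrite ?rowE.
  under [X in _ + X - _]eq_bigr => i _ do rewrite rowE.
  by rewrite -big_split -sumrB big1 // => i _ /=; ring.
have ge0 i j : 0 <= (G i j)%:R * (u 0 i - u 0 j) ^+ 2 by rewrite mulr_ge0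
  ?sqr_ge0 ?ler0n.
move=> /psumr_eq0P sum0.
have adj_eq i j : G i j -> u 0 i = u 0 j.
  move=> Gij; have /psumr_eq0P : \sum_j (G i j)%:R * (u 0 i - u 0 j) ^+ 2 = 0.
    by apply: sum0 => // h _; apply: sumr_ge0.
  move=> /(_ (fun j _ => ge0 i j) j isT); rewrite Gij mul1r => /eqP.
  by rewrite sqrf_eq0 subr_eq0 => /eqP.
(* The level set of [u] through [i] is closed under adjacency. *)
move=> i j; have clos : fingraph.closed (adj G) [pred h | u 0 i == u 0 h].
  by apply: intro_closed => [|x y /adj_eq xy];
    [exact/sym_connect_sym/adj_sym | rewrite !inE xy].
by have := closed_connect clos (conn i j); rewrite !inE eqxx => /esym/eqP.
Qed.

(** * Row sums, traces and eigenvectors of the alpha-adjacency matrix *)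

Variable alpha : R.
Let A := alpha_mx G alpha.

Lemma alpha_mxE i j :
  A i j = alpha * (degree G i)%:R *+ (i == j) + (1 - alpha) * (G i j)%:R.
Proof. by rewrite /A !mxE -mulrnAr. Qed.

Lemma alpha_mx_sym : A^T = A.
Proof.
apply/matrixP=> i j; rewrite mxE !alpha_mxE adj_sym eq_sym.
by case: eqP => [->|].
Qed.

Lemma alpha_mx_ge0 : 0 <= alpha <= 1 -> forall i j, 0 <= A i j.
Proof.
case/andP=> a0 a1 i j; rewrite alpha_mxE addr_ge0 //.
  by rewrite mulrn_wge0 ?mulr_ge0 ?ler0n.
by rewrite mulr_ge0 ?ler0n ?subr_ge0.
Qed.

Lemma row1_alpha_mx :
  (const_mx 1 : 'rV[R]_n) *m A = \row_i (degree G i)%:R.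
Proof.
apply/rowP=> j; rewrite !mxE.
under eq_bigr => i _ do rewrite mxE mul1r alpha_mxE adj_sym.
rewrite big_split /= -mulr_sumr row_sum_adj (bigD1 j) //= eqxx.
rewrite big1 => [|i /negPf->]; last by rewrite mulr0n.
by rewrite mulr1n; ring.
Qed.

Lemma trace_alpha_mx : \tr A = 2 * alpha * (num_edges G)%:R.
Proof.
rewrite /mxtrace (eq_bigr (fun i => alpha * (degree G i)%:R)) => [|i _].
  by rewrite -mulr_sumr sum_degreeR; ring.
by rewrite alpha_mxE eqxx adj_irr mulr1n mulr0 addr0.
Qed.

Lemma trace_alpha_mx_sqr :
  \tr (A *m A) = alpha ^+ 2 * (zagreb G)%:R +
    (1 - alpha) ^+ 2 * (2 * (num_edges G)%:R).
Proof.
rewrite -zagrebR -sum_degreeR !mulr_sumr -big_split /=.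
apply: eq_bigr => i _; rewrite mxE.
(* The degree and adjacency parts have disjoint supports, so no cross term arises. *)
have sqE j : A i j * A j i = (alpha * (degree G i)%:R) ^+ 2 *+ (i == j)
    + (1 - alpha) ^+ 2 * (G i j)%:R.
  have -> : A j i = A i j by rewrite -{1}alpha_mx_sym mxE.
  rewrite alpha_mxE; case: eqP => [<-|_].
    by rewrite adj_irr !mulr1n !mulr0 !addr0 -expr2.
  by rewrite !mulr0n !add0r; case: (G i j) => /=; ring.
under eq_bigr => j _ do rewrite sqE.
rewrite big_split /= -mulr_sumr row_sum_adj (bigD1 i) //= eqxx big1 => [|j].
  by rewrite mulr1n addr0; ring.
by rewrite eq_sym => /negPf->; rewrite mulr0n.
Qed.

Lemma alpha_mx_regular k : regular G k ->
  A = (alpha * k%:R)%:M + (1 - alpha) *: adjmx R G.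
Proof. by move=> reg; apply/matrixP=> i j; rewrite alpha_mxE reg !mxE. Qed.

(** Removing [alpha k] and dividing by [1 - alpha] turns [u] into an eigenvector of the adjacency
    matrix for [k]. *)
Lemma alpha_eigen_const k (u : 'rV[R]_n) :
    graph_connected G -> regular G k -> alpha != 1 ->
  u *m A = k%:R *: u -> exists c, u = const_mx c.
Proof.
move=> conn reg a1 uA.
have u_const : forall i j, u 0 i = u 0 j.
  apply: (connected_eigen_const conn reg).
  apply: (scalerI (_ : 1 - alpha != 0)); first by rewrite subr_eq0 eq_sym.
  move: uA; rewrite (alpha_mx_regular reg) mulmxDr mul_mx_scalar -scalemxAr.
  move/(canRL (addKr _)) => ->.
  by rewrite -scaleNr -scalerDl scalerA; congr (_ *: _); ring.
case: (posnP n) => [n0|n_gt0].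
  by exists 0; apply/rowP=> i; have := ltn_ord i; rewrite {2}n0.
by exists (u 0 (Ordinal n_gt0)); apply/rowP=> i; rewrite mxE; exact: u_const.
Qed.

End Graph.

Lemma connected_edges_gt0 n (G : sgraph n) :
  (1 < n)%N -> graph_connected G -> (0 < num_edges G)%N.
Proof.
case: n G => [|[|n]] // G _ conn; rewrite -(ltn_pmul2l (isT : 0 < 2)%N) muln0.
rewrite -sum_degree; have /connectP[[|z p] /= path_p] := conn ord0 ord_max.
  by move/(congr1 val).
move=> _; case/andP: path_p => Gz _; rewrite (bigD1 ord0) //= ltn_addr //.
by apply/card_gt0P; exists z; rewrite inE.
Qed.

(** * Root mean square degree against mean degree *)

Section ZagrebMean.
Variables (R : rcfType) (n : nat) (G : sgraph n).
Hypothesis n_gt0 : (0 < n)%N.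

Let mean : R := 2 * (num_edges G)%:R / n%:R.
Let q : R := Num.sqrt ((zagreb G)%:R / n%:R).

Let n0 : n%:R != 0 :> R. Proof. by rewrite pnatr_eq0 -lt0n. Qed.

(** [q^2] is the mean squared degree, so this is [n] times the variance. Its sign gives [mean <= q],
    and its vanishing gives regularity. *)
Lemma degree_variance :
  \sum_i ((degree G i)%:R - mean) ^+ 2 = n%:R * (q ^+ 2 - mean ^+ 2).
Proof.
rewrite sqr_sqrtr ?divr_ge0 ?ler0n //.
have sqrE i : ((degree G i)%:R - mean) ^+ 2
    = (degree G i)%:R ^+ 2 - 2 * mean * (degree G i)%:R + mean ^+ 2 by ring.
under eq_bigr => i _ do rewrite sqrE.
rewrite big_split sumrB /= -mulr_sumr sum_degreeR zagrebR sumr_const card_ord.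
by rewrite -[X in _ + X]mulr_natl /mean; field.
Qed.

Lemma mean_le_sqrt_zagreb : mean <= q.
Proof.
have mean_ge0 : 0 <= mean by rewrite divr_ge0 ?mulr_ge0 ?ler0n.
rewrite -(ler_pXn2r (ltn0Sn 1)) ?nnegrE ?sqrtr_ge0 // -subr_ge0.
rewrite -(pmulr_rge0 _ (_ : 0 < n%:R)) ?ltr0n // -degree_variance.
by apply: sumr_ge0 => i _; rewrite sqr_ge0.
Qed.

Lemma sqrt_zagreb_mean_degree : q = mean -> forall i, (degree G i)%:R = mean.
Proof.
move=> q_mean i; have /psumr_eq0P/(_ i isT)/eqP :
    \sum_i ((degree G i)%:R - mean) ^+ 2 = 0 :> R.
  by rewrite degree_variance q_mean subrr mulr0.
by rewrite sqrf_eq0 subr_eq0 => /(_ (fun j _ => sqr_ge0 _))/eqP.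
Qed.

Lemma regular_mean k : regular G k -> mean = k%:R.
Proof.
by move=> /regular_sum_degree edges;
  rewrite /mean -natrM edges natrM mulrC mulKf.
Qed.

Lemma regular_sqrt_zagreb k : regular G k -> q = k%:R.
Proof.
move=> reg; rewrite /q -zagrebR (eq_bigr (fun=> k%:R ^+ 2)) => [|i _].
  rewrite sumr_const card_ord -[X in X / _]mulr_natr mulfK //.
  by rewrite sqrtr_sqr ger0_norm ?ler0n.
by rewrite reg.
Qed.

End ZagrebMean.

(** With [sigma] the sum of the entries of [v], each coordinate reads [sigma = (x + 1) v j]. Summing
    gives [n sigma = (x + 1) sigma]; if [sigma = 0], a nonzero entry forces [x = -1]. *)
Lemma complete_eigenvalue (F : fieldType) n (A : 'M[F]_n) (x : F) :
    (forall i j, A i j = (i != j)%:R) -> eigenvalue A x ->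
  x = n%:R - 1 \/ x = -1.
Proof.
move=> AE /eigenvalueP[v vA v0]; pose sigma := \sum_j v 0 j.
have sigmaE j : sigma = (x + 1) * v 0 j.
  have /rowP/(_ j) := vA; rewrite !mxE mulrDl mul1r => <-.
  rewrite /sigma (bigD1 j) //= [RHS]addrC; congr (_ + _).
  rewrite [RHS](bigD1 j) //= AE eqxx mulr0 add0r.
  by apply: eq_bigr => k k'j; rewrite AE k'j mulr1.
have : n%:R * sigma = (x + 1) * sigma.
  rewrite [in RHS]/sigma mulr_sumr (eq_bigr (fun=> sigma)) => [|j _].
    by rewrite sumr_const card_ord mulr_natl.
  by rewrite -sigmaE.
move/eqP; rewrite -subr_eq0 -mulrBl mulf_eq0 => /orP[|/eqP sigma0].
  by rewrite subr_eq0 => /eqP->; left; rewrite addrK.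
right; have [j vj] : exists j, v 0 j != 0.
  apply/existsP; apply: contraR v0 => /existsPn v0.
  by apply/eqP/rowP => j; rewrite mxE; apply/eqP; rewrite -[_ == _]negbK v0.
have /eqP := sigmaE j; rewrite sigma0 eq_sym mulf_eq0 (negPf vj) orbF.
by rewrite addr_eq0 => /eqP.
Qed.

(** * Shifted eigenvalues and the extremal graphs *)

Section AlphaSpectrum.
Variables (R : rcfType) (n : nat) (G : sgraph n) (alpha : R).
Hypotheses (n_ge3 : (3 <= n)%N) (G_conn : graph_connected G).
Hypotheses (alpha_ge0 : 0 <= alpha) (alpha_le1 : alpha <= 1).
Hypothesis alpha_le : alpha <= 1 - n%:R / (2 * (num_edges G)%:R).

Variables (d : 'rV[R]_n) (P : 'M[R[i]]_n) (i0 : 'I_n).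
Hypothesis diagA : diagonalizes (alpha_mx G alpha) d P.
Hypothesis d_max : forall i, d 0 i <= d 0 i0.

Let m : R := (num_edges G)%:R.
Let t := 2 * alpha * m / n%:R.
Let q : R := Num.sqrt ((zagreb G)%:R / n%:R).
Let theta := q - t.
Let mean := 2 * m / n%:R.

Let n_gt0 : (0 < n)%N. Proof. exact: leq_trans n_ge3. Qed.
Let nR_gt0 : 0 < n%:R :> R. Proof. by rewrite ltr0n. Qed.
Let nR_neq0 : n%:R != 0 :> R. Proof. exact: lt0r_neq0. Qed.
Let m_gt0 : 0 < m.
Proof. by rewrite ltr0n connected_edges_gt0 // ltnW. Qed.
Let q_ge_mean : mean <= q. Proof. exact: mean_le_sqrt_zagreb. Qed.
Let t_mean : t = alpha * mean. Proof. by rewrite /t /mean; ring. Qed.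
Let t_ge0 : 0 <= t.
Proof. by rewrite t_mean mulr_ge0 ?divr_ge0 ?mulr_ge0 ?ler0n. Qed.

Let mean_ge : 1 <= (1 - alpha) * mean.
Proof.
have : n%:R / (2 * m) <= 1 - alpha by move: alpha_le; rewrite -/m; lra.
rewrite ler_pdivrMr ?mulr_gt0 ?ltr0Sn // => n_le.
by rewrite /mean [leRHS]mulrA ler_pdivlMr // mul1r.
Qed.

Let alpha_neq1 : alpha != 1.
Proof. by apply: contraTneq mean_ge => ->; rewrite subrr mul0r ler10. Qed.

(** [theta = q - alpha mean >= (1 - alpha) mean], which is at least 1 by the hypothesis on
    [alpha]. *)
Lemma theta_ge1 : 1 <= theta.
Proof. by move: mean_ge q_ge_mean; rewrite /theta t_mean; lra. Qed.

Let one : 'rV[R]_n := const_mx 1.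

Let sum_one : \sum_i one 0 i ^+ 2 = n%:R.
Proof.
rewrite (eq_bigr (fun=> 1)) => [|i _]; last by rewrite mxE expr1n.
by rewrite sumr_const card_ord.
Qed.

Let form_one : let A := alpha_mx G alpha in
  (one *m (A *m A) *m one^T) 0 0 = q ^+ 2 * \sum_i one 0 i ^+ 2.
Proof.
rewrite /= mulmxA row1_alpha_mx -mulmxA.
have -> : alpha_mx G alpha *m one^T = (one *m alpha_mx G alpha)^T.
  by rewrite trmx_mul alpha_mx_sym.
rewrite row1_alpha_mx dotmx_self sum_one.
under eq_bigr => i _ do rewrite mxE.
by rewrite zagrebR sqr_sqrtr ?divr_ge0 ?ler0n // mulfVK.
Qed.

Let abs_le i : `|d 0 i| <= d 0 i0.
Proof. by apply: (perron_bound diagA d_max); apply: alpha_mx_ge0;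
  rewrite alpha_ge0. Qed.

Lemma sqrt_zagreb_le : q <= d 0 i0.
Proof.
have := form_sqr_le diagA one abs_le.
rewrite form_one sum_one ler_pM2r //.
by rewrite ler_pXn2r ?nnegrE ?sqrtr_ge0 // (le_trans _ (abs_le i0)).
Qed.

(** The trace is [n t]: [t] is the average eigenvalue. *)
Lemma sum_shift : \sum_i (d 0 i - t) = 0.
Proof.
rewrite sumrB -(diagonalizes_trace diagA) trace_alpha_mx sumr_const card_ord.
by rewrite -[X in _ - X]mulr_natr /t; field.
Qed.

Lemma sum_shift_sqr : \sum_i (d 0 i - t) ^+ 2
  = alpha ^+ 2 * (zagreb G)%:R + (1 - alpha) ^+ 2 * (2 * m) - n%:R * t ^+ 2.
Proof.
have sqrE i : (d 0 i - t) ^+ 2 = d 0 i * d 0 i - (2 * t * (d 0 i - t) + t ^+ 2).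
  by ring.
under eq_bigr => i _ do rewrite sqrE.
rewrite sumrB big_split /= -mulr_sumr sum_shift mulr0 add0r.
rewrite sumr_const card_ord -[X in _ - X]mulr_natl; congr (_ - _).
rewrite -trace_alpha_mx_sqr (diagonalizes_trace (diagonalizes_mul diagA diagA)).
by apply: eq_bigr => i _; rewrite mxE.
Qed.

Let extremal := d 0 i0 - t = theta /\ forall i, i != i0 -> `|d 0 i - t| = 1.

(** Since [q <= d i0], the largest shift is at least [theta > 1], so [d i0 = k]; simplicity of [k]
    puts all other shifts at modulus 1. *)
Lemma extremal_regular k : regular G k -> theta != 1 ->
  (forall i, d 0 i = k%:R \/ `|d 0 i - t| = 1) -> extremal.
Proof.
move=> reg theta1 dP; have qk : q = k%:R by exact: regular_sqrt_zagreb.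
have theta_gt1 : 1 < theta by rewrite lt_neqAle eq_sym theta1 theta_ge1.
have di0 : d 0 i0 = k%:R.
  have [//|s1] := dP i0; have := sqrt_zagreb_le; have := ler_norm (d 0 i0 - t).
  by rewrite s1 => *; exfalso; move: theta_gt1; rewrite /theta; lra.
split=> [|i i'i0]; first by rewrite di0 /theta qk.
have [di|//] := dP i; case/eqP: i'i0.
by apply: (diagonalizes_simple diagA _ di di0) => u; exact: alpha_eigen_const.
Qed.

Lemma extremal_theta1 : extremal -> theta != 1.
Proof.
move=> [si0 s1]; apply/eqP => theta1.
(* [theta = 1] makes [mean <= q] and [1 <= (1 - alpha) mean] both tight. *)
have q_mean : q = mean by move: mean_ge q_ge_mean theta1;
  rewrite /theta t_mean; lra.
have deg := sqrt_zagreb_mean_degree n_gt0 q_mean.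
have mean1 : (1 - alpha) * mean = 1 by move: theta1;
  rewrite /theta t_mean q_mean; lra.
have : \sum_i (d 0 i - t) ^+ 2 = n%:R.
  rewrite (eq_bigr (fun=> 1)) => [|i _]; first by rewrite sumr_const card_ord.
  rewrite -real_normK ?num_real //; have [->|/s1->] := eqVneq i i0.
    by rewrite si0 theta1 normr1 expr1n.
  by rewrite expr1n.
rewrite sum_shift_sqr.
have -> : (zagreb G)%:R = n%:R * mean ^+ 2.
  by rewrite -q_mean sqr_sqrtr ?divr_ge0 ?ler0n // mulrC mulfVK.
have -> : 2 * m = n%:R * mean by rewrite /mean [RHS]mulrC mulfVK.
rewrite t_mean => sum_n.
(* All [n] shifts have modulus 1; comparing with the trace formula, where the [alpha^2 mean^2] terms
   cancel, leaves this identity. *)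
have : (1 - alpha) * ((1 - alpha) * mean) = 1.
  by apply: (mulfI nR_neq0); rewrite mulr1 -[RHS]sum_n; ring.
rewrite mean1 mulr1 => alpha0; have {}alpha0 : alpha = 0 by lra.
have reg : regular G 1.
  move=> i; apply/eqP; rewrite -(eqr_nat R) deg.
  by move: mean1; rewrite alpha0 subr0 mul1r -/m -/mean => ->.
by have := connected_1regular G_conn reg; rewrite leqNgt n_ge3.
Qed.

Lemma extremal_is_regular : extremal -> exists2 k, regular G k &
  theta = (1 - alpha) * k%:R.
Proof.
move=> ext; have [si0 s1] := ext; have theta1 := extremal_theta1 ext.
have theta_gt1 : 1 < theta by rewrite lt_neqAle eq_sym theta1 theta_ge1.
have di0 : d 0 i0 = q by move: si0; rewrite /theta; lra.
(* For [i != i0], [|d i| <= 1 + t < theta + t = q]. *)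
have dq i : d 0 i = q \/ `|d 0 i| < q.
  have [->|/s1 s_i] := eqVneq i i0; [by left | right].
  apply: (@le_lt_trans _ _ (1 + t)); last by move: theta_gt1; rewrite /theta;
    lra.
  by rewrite -s_i -[X in _ + X](ger0_norm t_ge0) -{1}(subrK t (d 0 i))
    ler_normD.
have := form_sqr_eq diagA (alpha_mx_sym G alpha) dq form_one.
rewrite row1_alpha_mx => /rowP deg.
have degq i : (degree G i)%:R = q by have := deg i; rewrite !mxE mulr1.
have reg : regular G (degree G i0).
  by move=> i; apply/eqP; rewrite -(eqr_nat R) !degq.
exists (degree G i0) => //.
have mean_k : mean = (degree G i0)%:R by exact: regular_mean.
rewrite /theta t_mean mean_k degq; ring.
Qed.

Lemma extremalP : extremal <->
  (graph_iso G (complete_graph n) /\ alpha = 0) \/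
  (exists k : nat,
     let s : seq R := [:: k%:R; alpha * k%:R + 1; alpha * k%:R - 1] in
     [/\ regular G k, uniq s &
         forall x : R, eigenvalue (alpha_mx G alpha) x = (x \in s)]).
Proof.
split=> [ext|].
  have [si0 s1] := ext; have theta1 := extremal_theta1 ext.
  have [k reg thetaE] := extremal_is_regular ext.
  have tk : t = alpha * k%:R by rewrite t_mean /mean (regular_mean R n_gt0 reg).
  have theta_gt1 : 1 < theta by rewrite lt_neqAle eq_sym theta1 theta_ge1.
  have s_pm i : i != i0 -> d 0 i = t + 1 \/ d 0 i = t - 1.
    move=> /s1/eqP; rewrite eqr_norml ler01 andbT => /orP[]/eqP e.
      by left; lra.
    by right; lra.
  have sum_other : theta + \sum_(i | i != i0) (d 0 i - t) = 0.
    by rewrite -si0 -[RHS]sum_shift [RHS](bigD1 i0).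
  have card_other : \sum_(i < n | i != i0) 1 = n%:R - 1 :> R.
    have : \sum_(i < n) 1 = n%:R :> R by rewrite sumr_const card_ord.
    by rewrite (bigD1 i0) //=; lra.
  have [/existsP[i1 /andP[i1'i0 /eqP di1]]|no_plus] :=
      boolP [exists i, (i != i0) && (d 0 i == t + 1)].
    right; exists k => s; split=> //.
      by rewrite /s /= !inE; apply/and3P; split=> //; rewrite ?negb_or;
        [apply/andP; split|];
       apply/eqP => e; move: theta_gt1; rewrite thetaE; lra.
    (* Without the value [t - 1] every shift would be positive, against their zero sum. *)
    have [/existsP[i2 /andP[i2'i0 /eqP di2]]|no_minus] :=
        boolP [exists i, (i != i0) && (d 0 i == t - 1)]; last first.
      have : 0 < theta + \sum_(i | i != i0) (d 0 i - t).
        rewrite ltr_wpDr ?(lt_trans ltr01) //.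
        apply: sumr_ge0 => i i'i0; have [->|di] := s_pm i i'i0.
          by rewrite addrAC subrr add0r ler01.
        by case/existsP: no_minus; exists i; rewrite i'i0 di eqxx.
      by rewrite sum_other ltxx.
    move=> x; rewrite (diagonalizes_eigenvalue _ diagA) /s !inE -tk.
    have di0 : d 0 i0 = k%:R by move: si0; rewrite thetaE tk; lra.
    apply/codomP/idP => [[i ->]|].
      have [->|/s_pm[]->] := eqVneq i i0; rewrite ?di0 ?eqxx ?orbT //.
    by case/or3P => /eqP->; [exists i0 | exists i1 | exists i2].
  left; have theta_n : theta = n%:R - 1.
    have all_minus : \sum_(i | i != i0) (d 0 i - t) =
      - \sum_(i < n | i != i0) 1.
      rewrite -sumrN; apply: eq_bigr => i i'i0.
      have [di|->] := s_pm i i'i0; last by ring.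
      by case/existsP: no_plus; exists i; rewrite i'i0 di eqxx.
    by move: sum_other; rewrite all_minus card_other; lra.
  have k_le : (k <= n.-1)%N by rewrite -(reg i0) degree_le.
  have n1 : n%:R - 1 = n.-1%:R :> R by rewrite -[in LHS](prednK n_gt0) -addn1
    natrD addrK.
  have kR_le : k%:R <= n%:R - 1 :> R by rewrite n1 ler_nat.
  have ak_ge0 : 0 <= alpha * k%:R by rewrite mulr_ge0 ?ler0n.
  (* From [(1 - alpha) k = n - 1] with [k <= n - 1] and [alpha k >= 0]. *)
  have kn : k%:R = n%:R - 1 :> R by lra.
  have ak0 : alpha * k%:R = 0 by lra.
  split.
    have kE : k = n.-1 by apply/eqP; rewrite -(eqr_nat R) kn n1.
    exists id; split; first by exists id.
    by move=> i j; apply: regular_complete; rewrite -kE.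
  move/eqP: ak0; rewrite mulf_eq0 => /orP[/eqP//|/eqP k0].
  by move: theta_gt1; rewrite thetaE k0 mulr0 ltr10.
case=> [[iso alpha0]|[k [reg uniq_s eigE]]].
  have reg := iso_complete_regular iso.
  have n1 : n.-1%:R = n%:R - 1 :> R by rewrite -[in RHS](prednK n_gt0) -addn1
    natrD addrK.
  have t0 : t = 0 by rewrite t_mean alpha0 mul0r.
  have qn : q = n.-1%:R by exact: regular_sqrt_zagreb.
  apply: (extremal_regular reg) => [|i].
    by rewrite /theta t0 subr0 qn -[1]/(1%:R) eqr_nat;
      case: n n_ge3 => [|[|[]]].
  rewrite t0 subr0 n1.
  have : eigenvalue (alpha_mx G alpha) (d 0 i).
    by rewrite (diagonalizes_eigenvalue _ diagA) codom_f.
  move=> /complete_eigenvalue[].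
  - move=> a b; rewrite alpha_mxE alpha0 mul0r mul0rn add0r subr0 mul1r.
    by rewrite regular_complete.
  - by left.
  - by move=> ->; right; rewrite normrN1.
have mean_k : mean = k%:R by exact: regular_mean.
have qk : q = k%:R by exact: regular_sqrt_zagreb.
apply: (extremal_regular reg) => [|i].
  (* [theta = 1] would make the listed values [k] and [alpha k + 1] coincide. *)
  apply: contraTneq uniq_s => theta1.
  have /eqP ke : k%:R = alpha * k%:R + 1.
    by move: theta1; rewrite /theta t_mean mean_k qk; lra.
  by rewrite /= inE ke.
have : d 0 i \in [:: k%:R; alpha * k%:R + 1; alpha * k%:R - 1].
  by rewrite -eigE (diagonalizes_eigenvalue _ diagA) codom_f.
rewrite !inE t_mean mean_k => /or3P[]/eqP->; [by left|right|right].
  by rewrite addrAC subrr add0r normr1.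
by rewrite addrAC subrr add0r normrN1.
Qed.

End AlphaSpectrum.

(* The logarithmic term is taken in the extended reals, where r / 0 = +oo for
   r > 0 and lne +oo = +oo: if Gamma = 0 the bound is +oo, and if Gamma is
   nonzero the term is the real number ln (theta / Gamma), as theta > 0. *)
Theorem theorem2p13 (R : realType) (n : nat) (G : sgraph n) (alpha : R)
    (n_ge3 : (3 <= n)%N) (G_conn : graph_connected G)
    (alpha_ge0 : 0 <= alpha) (alpha_le1 : alpha <= 1)
    (alpha_le : alpha <= 1 - n%:R / (2 * (num_edges G)%:R)) :
  let m : R := (num_edges G)%:R in
  let N : R := n%:R in
  let Zg : R := (zagreb G)%:R in
  let A := alpha_mx G alpha in
  let Gamma : R := `|\det (A - (2 * alpha * m / N)%:M)| in
  let theta : R := Num.sqrt (Zg / N) - 2 * alpha * m / N in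
  let bound : \bar R :=
    ((alpha ^+ 2 * Zg + (1 - alpha) ^+ 2 * frobenius_norm (adjmx R G) ^+ 2
      - 2 * alpha * m / N ^+ 2 * (2 * alpha * N * m + 2 * alpha * m + N))%:E
     + lne (theta%:E / Gamma%:E)
     + (4 * alpha * m / N * Num.sqrt (Zg / N)
        - Num.sqrt (Zg / N) * (Num.sqrt (Zg / N) - 1))%:E)%E in
  ((alpha_energy G alpha)%:E <= bound)%E /\
  ((alpha_energy G alpha)%:E = bound <->
     (graph_iso G (complete_graph n) /\ alpha = 0) \/
     (exists k : nat,
        let s : seq R := [:: k%:R; alpha * k%:R + 1; alpha * k%:R - 1] in
        [/\ regular G k, uniq s & forall x : R, eigenvalue A x = (x \in s)])).
Proof.
move=> m N Zg A Gamma theta bound.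
have [d [P diagA]] := symmetric_diagonalizes (alpha_mx_sym G alpha).
have n_gt0 : (0 < n)%N by exact: leq_trans n_ge3.
have [i0 d_max] : exists i0, forall i, d 0 i <= d 0 i0.
  case: (@arg_maxP _ _ _ (Ordinal n_gt0) predT (d 0)) => // i0 _ d_max.
  by exists i0 => i; exact: d_max.
set t := 2 * alpha * m / N in Gamma theta bound *.
have energyE : alpha_energy G alpha = \sum_i `|d 0 i - t|.
  by rewrite /alpha_energy (perm_big _ (perm_spectrum diagA)) big_map big_enum.
have GammaE : Gamma = \prod_i `|d 0 i - t|.
  rewrite /Gamma (diagonalizes_det (diagonalizes_sub_scalar t diagA))
    normr_prod.
  by apply: eq_bigr => i _; rewrite mxE.
have theta1 : 1 <= theta by exact: theta_ge1.
have theta_gt0 : 0 < theta by exact: lt_le_trans theta1.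
have theta_le : theta <= d 0 i0 - t.
  by rewrite lerD2r; exact:
    (sqrt_zagreb_le n_ge3 alpha_ge0 alpha_le1 diagA d_max).
have := extremalP n_ge3 G_conn alpha_ge0 alpha_le1 alpha_le diagA d_max.
rewrite -/m -/N -/t -/Zg -/theta => <-.
have [Gamma0|Gamma0] := eqVneq Gamma 0.
  have -> : bound = +oo%E.
    rewrite /bound Gamma0 inver eqxx gt0_muley ?lte_fin //.
  split; first exact: leey.
  split=> // -[si0 s1]; exfalso; move/eqP: Gamma0; rewrite GammaE.
  (* In the extremal case each shift is [theta > 0] or has modulus 1, so the product cannot
     vanish. *)
  apply/negP/prodf_neq0 => i _; have [->|/s1->] := eqVneq i i0.
    by rewrite si0 normr_eq0 gt_eqF.
  exact: oner_neq0.
have s0 i : d 0 i - t != 0.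
  by move: Gamma0; rewrite GammaE => /prodf_neq0/(_ i isT); rewrite normr_eq0.
have boundE : bound = (\sum_i (d 0 i - t) ^+ 2
    + ln (theta / \prod_i `|d 0 i - t|)
               - theta ^+ 2 + theta)%:E.
  rewrite /bound -GammaE inver (negPf Gamma0) -EFinM lne_EFin; last first.
    by rewrite divr_gt0 // lt_neqAle eq_sym Gamma0 normr_ge0.
  rewrite -!EFinD; congr EFin; rewrite frobenius_adj.
  (* As [2 alpha m = n t], the subtracted product is [n t^2 + t^2 + t]: the first term comes from
     the sum of squares, the others from [theta - theta^2] with [theta = q - t], where [q] is the
     root of [Zg / N]. *)
  rewrite (sum_shift_sqr n_ge3 diagA) -/m -/N -/t -/Zg /theta /t.
  by field; rewrite pnatr_eq0 -lt0n.
have [le eq] := sum_norm_le theta1 theta_le s0.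
rewrite energyE boundE lee_fin; split=> //.
by split=> [[/eq]|/eq->].
Qed.
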